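(* Let $\mathbf{X}$ be a real vector space with norm $|\cdot|$, let $1<p<\infty$, $\mathbf{Z}=\{(x,y)\in\mathbf{X}\times\mathbb{R}_+:|x|\le y\}$, and for $(x,y)\in\mathbf{Z}$, $d\in\mathbf{X}$ let \[ \phi(x,y,d)=(x+d,\;y\vee|x+d|),\qquad f(x,y)=y^p-\Big(\tfrac{p}{p-1}\Big)^p|x|^p . \] Then the minimal fixed point of the operator $A$ (associated with $\phi$) dominating $f$ is given by \[ A^\infty f(x,y)=\begin{cases} f(x,y) & \text{if } |x|<\tfrac{p-1}{p}y,\\[2pt] \tilde u(x,y) & \text{if } |x|\ge\tfrac{p-1}{p}y,\end{cases} \qquad\text{where}\quad \tilde u(x,y):=p\,y^p-\tfrac{p^2}{p-1}|x|\,y^{p-1},\quad (x,y)\in\mathbf{Z}. \]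
   Context: $\overline{\mathbb{R}}=[-\infty,\infty]$, with the convention $\infty-\infty=-\infty$, used in particular in the definition of concavity: $\psi:\mathbf{X}\to\overline{\mathbb{R}}$ is concave if $\psi(\lambda x+(1-\lambda)x')\ge\lambda\psi(x)+(1-\lambda)\psi(x')$ for all $x,x'\in\mathbf{X}$, $\lambda\in(0,1)$. For $h:\mathbf{X}\to\overline{\mathbb{R}}$, the concave envelope is $h^\sharp(x)=\inf\{\psi(x)\mid\psi:\mathbf{X}\to\overline{\mathbb{R}}\text{ concave},\ \psi\ge h\}$. The operator $A$ acts on functions $g:\mathbf{Z}\to\overline{\mathbb{R}}$ by $Ag(z)=[g\circ\phi(z,\cdot)]^\sharp(0)$, $z=(x,y)\in\mathbf{Z}$ (the concave envelope of $d\mapsto g(\phi(z,d))$ on $\mathbf{X}$, evaluated at $d=0$). $A^n$ is the $n$-fold composition and $A^\infty f=\lim_{n\to\infty}A^nf$ (pointwise, nondecreasing limit), which is the smallest function $u:\mathbf{Z}\to\overline{\mathbb{R}}$ with $Au=u$ and $u\ge f$. $a\vee b=\max\{a,b\}$, $\mathbb{R}_+=[0,\infty)$. *)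

(* Defs.v *)
From mathcomp Require Import all_boot all_order all_algebra.
From mathcomp Require Import all_classical all_reals all_analysis.
Set Implicit Arguments.
Unset Strict Implicit.
Unset Printing Implicit Defensive.
Import Order.TTheory GRing.Theory Num.Theory.
Import numFieldNormedType.Exports.
Local Open Scope classical_set_scope.
Local Open Scope ring_scope.
Local Open Scope ereal_scope.

(* The addition of \bar R satisfies +oo + -oo = -oo, which is the convention
   under which concavity of extended-real-valued functions is meant here. *)
Definition econcave (R : realType) (X : lmodType R) (psi : X -> \bar R) : Prop :=
  forall (x x' : X) (l : R), (0 < l)%R -> (l < 1)%R ->
    l%:E * psi x + (1 - l)%:E * psi x' <= psi (l *: x + (1 - l) *: x')%R.

Definition concave_envelope (R : realType) (X : lmodType R)
    (h : X -> \bar R) (x : X) : \bar R :=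
  ereal_inf [set psi x | psi in
    [set psi : X -> \bar R | econcave psi /\ forall x', h x' <= psi x']].

Definition opA (R : realType) (X : lmodType R) (Z : Type) (phi : Z -> X -> Z)
    (g : Z -> \bar R) : Z -> \bar R :=
  fun z => concave_envelope (fun d => g (phi z d)) 0%R.

Definition opA_infty (R : realType) (X : lmodType R) (Z : Type)
    (phi : Z -> X -> Z) (g : Z -> \bar R) : Z -> \bar R :=
  fun z => limn (fun n => iter n (opA phi) g z).

Definition is_minimal_fixed_point (R : realType) (Z : Type)
    (T : (Z -> \bar R) -> (Z -> \bar R)) (g u : Z -> \bar R) : Prop :=
  [/\ T u = u,
      forall z, g z <= u z
    & forall v : Z -> \bar R, T v = v -> (forall z, g z <= v z) ->
        forall z, u z <= v z].

Definition coneZ (R : realType) (X : normedModType R) : Type :=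
  {z : X * R | ((0 <= z.2) && (`|z.1| <= z.2))%R}.

Section Cone.
Variables (R : realType) (X : normedModType R).

Definition xpart (z : coneZ X) : X := (sval z).1.
Definition ypart (z : coneZ X) : R := (sval z).2.

Lemma phi_subproof (z : coneZ X) (d : X) :
  let w := (xpart z + d, Num.max (ypart z) `|xpart z + d|)%R in
  ((0 <= w.2) && (`|w.1| <= w.2))%R.
Proof. by rewrite /= !le_max normr_ge0 lexx !orbT. Qed.

Definition phi (z : coneZ X) (d : X) : coneZ X :=
  exist _ (xpart z + d, Num.max (ypart z) `|xpart z + d|)%R (phi_subproof z d).

Definition payoff (p : R) (z : coneZ X) : R :=
  (ypart z `^ p - (p / (p - 1)) `^ p * `|xpart z| `^ p)%R.

Definition utilde (p : R) (z : coneZ X) : R :=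
  (p * ypart z `^ p
   - p ^+ 2 / (p - 1) * `|xpart z| * ypart z `^ (p - 1))%R.

End Cone.

(* Main.v *)
(** Along the trajectories of [phi], the candidate [u] ([bellman]) is a minimum
    of functions affine and nonincreasing in [|x|]; hence
    [d |-> u (phi z d)] is concave, [A u = u] and [A^oo f <= u].
    Conversely, the limit [w] of the iterates satisfies
    [l w(phi z d) + (1 - l) w(phi z d') <= w z] whenever [l d + (1 - l) d' = 0].
    From a diagonal point [(x, |x|)], move either to [(a x, a |x|)], [a > 1], or to
    [((b / q) x, |x|)], [b > 1], where [w >= f], with [q = p / (p - 1)].  If [C] is
    the best constant with [w (x, |x|) >= - C |x|^p], letting [a -> 1] and then
    [b -> 1] gives [C <= q].  Interpolating between the diagonal and the line
    [|x| = y / q], where [f = 0], yields [w >= utilde] for [|x| >= y / q]. *)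
Require Import Defs.
From mathcomp Require Import all_boot all_order all_algebra.
From mathcomp Require Import all_classical all_reals all_analysis.
From mathcomp Require Import ring lra.
Import Order.TTheory GRing.Theory Num.Theory.
Import numFieldNormedType.Exports.
Local Open Scope classical_set_scope.
Local Open Scope ring_scope.

(** * Tangent bounds and concavity for the candidate in the radial variable *)

(** Young's inequality with exponents [p] and [p / (p - 1)], applied to [b] and [a^(p-1)]. It says
    that [t^p] lies above its tangent at [a], and is used below in that sense. *)
Lemma powR_young {R : realType} (p a b : R) : 1 < p -> 0 <= a -> 0 <= b ->
  p * (a `^ (p - 1) * b) <= b `^ p + (p - 1) * a `^ p.
Proof.
move=> p1 a0 b0; have p0 : 0 < p by lra.
have q0 : 0 < p / (p - 1) by rewrite divr_gt0 //; lra.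
have conj : p^-1 + (p / (p - 1))^-1 = 1 by field; apply/andP; split; lra.
have := conjugate_powR b0 (powR_ge0 a (p - 1)) p0 q0 conj.
have -> : (a `^ (p - 1)) `^ (p / (p - 1)) = a `^ p.
  by rewrite -powRrM; congr (_ `^ _); field; lra.
move=> /(ler_wpM2l (ltW p0)); rewrite [b * _]mulrC => /le_trans; apply.
by rewrite le_eqVlt; apply/orP; left; apply/eqP; field; apply/andP; split; lra.
Qed.

Definition bellman {R : realType} (p r y : R) : R :=
  if r < (p - 1) / p * y then y `^ p - (p / (p - 1)) `^ p * r `^ p
  else p * y `^ p - p ^+ 2 / (p - 1) * r * y `^ (p - 1).

(* The bounds are the tangents, as functions of [r], of the C^1 concave function
   [r |-> bellman p r (max y r)]; the tangent at [r] is the one with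
   [k = min (q r, max y r)]. *)
Lemma bellman_le_affine {R : realType} (p y r k : R) :
  1 < p -> 0 <= y -> 0 <= r -> 0 <= k ->
  bellman p r (Num.max y r) <=
    Num.max y k `^ p + (p - 1) * k `^ p - p ^+ 2 / (p - 1) * (k `^ (p - 1) * r).
Proof.
move=> p1 y0 r0 k0; have p0 : 0 < p by lra.
set q := p / (p - 1).
have qE : q * (p - 1) = p by rewrite /q; field; lra.
have q1 : 1 < q by rewrite /q ltr_pdivlMr; lra.
have -> : p ^+ 2 / (p - 1) = p * q by rewrite /q; field; lra.
have thr w : (p - 1) / p * w = w / q.
  by rewrite /q; field; apply/andP; split; lra.
have pwE (w : R) : 0 <= w -> w `^ p = w * w `^ (p - 1).
  by move=> w0; rewrite mulr_powRB1.
have mono (s t : R) : 0 <= s -> s <= t -> s `^ p <= t `^ p.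
  by move=> s0 st; apply: ge0_ler_powR; rewrite ?nnegrE; lra.
have mono1 (s t : R) : 0 <= s -> s <= t -> s `^ (p - 1) <= t `^ (p - 1).
  by move=> s0 st; apply: ge0_ler_powR; rewrite ?nnegrE; lra.
have yk : y `^ p <= Num.max y k `^ p by apply: mono => //; rewrite le_max lexx.
have kk : k `^ p <= Num.max y k `^ p by apply: mono => //; rewrite le_max lexx orbT.
have qr0 : 0 <= q * r by apply: mulr_ge0 => //; lra.
rewrite /bellman -/q thr; have -> : p ^+ 2 / (p - 1) = p * q by rewrite /q; field; lra.
case: ltP => [|].
  have [ry|yr] := leP r y.
    rewrite -powRM; [|lra|lra] => _.
    have := powR_young _ _ _ p1 k0 qr0.
    lra.
  by rewrite ltr_pdivlMr; [nra|lra].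
rewrite ler_pdivrMr; last lra.
have [ry|yr] := leP r y => h.
  (* For [k <= y], Young at [(k, y)] reduces the claim to [(y - q r) (y^(p-1) - k^(p-1)) <= 0],
     where the first factor is nonpositive on this branch. For [k > y], [r <= y] replaces [r] by
     [y], and [q] times Young concludes through [p q = p + q]. *)
  have [ky|yk'] := leP k y.
    have e1 := powR_young _ _ _ p1 k0 y0.
    have e2 := mono1 _ _ k0 ky.
    have e3 : y * (y `^ (p - 1) - k `^ (p - 1)) <=
        (q * r) * (y `^ (p - 1) - k `^ (p - 1)).
      by apply: ler_wpM2r; lra.
    have e4 : p * (y * (y `^ (p - 1) - k `^ (p - 1))) <=
        p * ((q * r) * (y `^ (p - 1) - k `^ (p - 1))).
      by rewrite ler_pM2l.
    have e5 := pwE y y0.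
    have e6 : p * y `^ p = p * (y * y `^ (p - 1)) by rewrite e5.
    lra.
  have e1 := powR_young _ _ _ p1 k0 y0.
  have e2 := mono1 _ _ y0 (ltW yk').
  have e3 : p * q * r * (k `^ (p - 1) - y `^ (p - 1)) <=
      p * q * y * (k `^ (p - 1) - y `^ (p - 1)).
    apply: ler_wpM2r; first lra.
    by apply: ler_wpM2l => //; apply: mulr_ge0; lra.
  have e5 := pwE y y0.
  have e4 : q * (p * (k `^ (p - 1) * y)) <= q * (y `^ p + (p - 1) * k `^ p).
    by rewrite ler_pM2l //; lra.
  have e6 : p * q * (y `^ p) = p * q * (y * y `^ (p - 1)) by rewrite e5.
  have e7 : q * p = q + p by nra.
  have e8 : q * ((p - 1) * k `^ p) = p * k `^ p by rewrite mulrA qE.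
  have e9 : q * p * y `^ p = q * y `^ p + p * y `^ p by rewrite e7 mulrDl.
  lra.
have e1 := powR_young _ _ _ p1 k0 r0.
have e5 := pwE r r0.
have e4 : q * (p * (k `^ (p - 1) * r)) <= q * (r `^ p + (p - 1) * k `^ p).
  by rewrite ler_pM2l //; lra.
have e6 : p * q * (r `^ p) = p * q * (r * r `^ (p - 1)) by rewrite e5.
have e7 : q * p = q + p by nra.
have e8 : q * ((p - 1) * k `^ p) = p * k `^ p by rewrite mulrA qE.
have e9 : q * p * r `^ p = q * r `^ p + p * r `^ p by rewrite e7 mulrDl.
lra.
Qed.

Lemma bellman_eq_affine {R : realType} (p y r : R) :
  1 < p -> 0 <= y -> 0 <= r ->
  exists2 k, 0 <= k & bellman p r (Num.max y r) =
    Num.max y k `^ p + (p - 1) * k `^ p - p ^+ 2 / (p - 1) * (k `^ (p - 1) * r).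
Proof.
move=> p1 y0 r0; have p0 : 0 < p by lra.
set q := p / (p - 1).
have q1 : 1 < q by rewrite /q ltr_pdivlMr; lra.
have -> : p ^+ 2 / (p - 1) = p * q by rewrite /q; field; lra.
have thr w : (p - 1) / p * w = w / q.
  by rewrite /q; field; apply/andP; split; lra.
have qr0 : 0 <= q * r by apply: mulr_ge0 => //; lra.
rewrite /bellman -/q thr; have -> : p ^+ 2 / (p - 1) = p * q by rewrite /q; field; lra.
case: ltP => [|].
  have [ry|yr] := leP r y; last by rewrite ltr_pdivlMr; [nra|lra].
  rewrite ltr_pdivlMr => [h|]; last lra.
  exists (q * r) => //.
  rewrite -powRM; [|lra|lra].
  have -> : Num.max y (q * r) = y by apply/max_idPl; lra.
  have := mulr_powRB1 qr0 p0.
  move=> e; have : p * ((q * r) * (q * r) `^ (p - 1)) = p * (q * r) `^ p by rewrite e.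
  lra.
move=> _; exists (Num.max y r); first by rewrite le_max y0.
rewrite maxA maxxx; lra.
Qed.

(** The tangent attained at the norm of the combination also bounds the values at [x] and [x']. Its
    slope in the norm is nonpositive, so the triangle inequality goes in the right direction. *)
Lemma bellman_concave {R : realType} {X : normedModType R} (p y : R) :
  1 < p -> 0 <= y ->
  forall (x x' : X) (l : R), 0 < l -> l < 1 ->
    l * bellman p `|x| (Num.max y `|x|)
      + (1 - l) * bellman p `|x'| (Num.max y `|x'|)
    <= bellman p `|l *: x + (1 - l) *: x'| (Num.max y `|l *: x + (1 - l) *: x'|).
Proof.
move=> p1 y0 x x' l l0 l1.
have [k k0 ->] := bellman_eq_affine p y _ p1 y0 (normr_ge0 (l *: x + (1 - l) *: x')).
have h1 := bellman_le_affine p y _ k p1 y0 (normr_ge0 x) k0.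
have h2 := bellman_le_affine p y _ k p1 y0 (normr_ge0 x') k0.
have l1' : 0 < 1 - l by lra.
apply: (le_trans (lerD (ler_wpM2l (ltW l0) h1) (ler_wpM2l (ltW l1') h2))).
have hn : `|l *: x + (1 - l) *: x'| <= l * `|x| + (1 - l) * `|x'|.
  by rewrite (le_trans (ler_normD _ _))// !normrZ !gtr0_norm.
have c0 : 0 <= p ^+ 2 / (p - 1) * k `^ (p - 1).
  by rewrite mulr_ge0 ?powR_ge0// divr_ge0 ?sqr_ge0//; lra.
have := ler_wpM2l c0 hn.
lra.
Qed.

(** * Elementary properties of concave envelopes *)

Section Envelope.
Context {R : realType} {X : lmodType R}.
Implicit Types h : X -> \bar R.

Lemma concave_envelope_ge h x : (h x <= concave_envelope h x)%E.
Proof. by apply: le_ereal_inf_tmp => _ [psi [_ hpsi] <-]. Qed.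

Lemma concave_envelope_le h x : econcave h -> (concave_envelope h x <= h x)%E.
Proof. by move=> ch; apply: ereal_inf_lbound; exists h. Qed.

Lemma le_concave_envelope h h' x : (forall t, h t <= h' t)%E ->
  (concave_envelope h x <= concave_envelope h' x)%E.
Proof.
move=> hh'; apply: ereal_inf_le_tmp => _ [psi [cpsi hpsi] <-].
by exists psi => //; split=> // t; exact: le_trans (hpsi t).
Qed.

(** Every concave majorant of [h] satisfies this inequality, hence so does their infimum. *)
Lemma concave_envelope_convex h d d' (l : R) : 0 < l -> l < 1 ->
  (l%:E * h d + (1 - l)%:E * h d' <=
    concave_envelope h (l *: d + (1 - l) *: d')%R)%E.
Proof.
move=> l0 l1; apply: le_ereal_inf_tmp => _ [psi [cpsi hpsi] <-].
apply: le_trans (cpsi _ _ _ l0 l1).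
apply: leeD; apply: lee_wpmul2l => //; rewrite lee_fin; first exact: ltW.
all: by rewrite subr_ge0 ltW.
Qed.

End Envelope.

(** * The operator on the cone, its iterates and their limit *)

Section Operator.
Context {R : realType} {X : normedModType R}.
Implicit Types (g h u : coneZ X -> \bar R) (z : coneZ X) (d : X).

Let A := opA (@phi R X).

Lemma ypart_ge0 z : 0 <= ypart z.
Proof. by have /andP[] := svalP z. Qed.

Lemma xpart_le z : `|xpart z| <= ypart z.
Proof. by have /andP[] := svalP z. Qed.

Lemma coneZ_inj z z' : xpart z = xpart z' -> ypart z = ypart z' -> z = z'.
Proof.
case: z z' => [[x y] h] [[x' y'] h']; rewrite /xpart /ypart /= => ex ey.
by apply: val_inj; rewrite /= ex ey.
Qed.

Lemma phi0 z : phi z 0 = z.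
Proof.
apply: coneZ_inj; rewrite /xpart /ypart /= addr0 //.
by apply/max_idPl; exact: xpart_le.
Qed.

Lemma opA_ge g z : (g z <= A g z)%E.
Proof.
rewrite -[in leLHS](phi0 z).
exact: (concave_envelope_ge (fun d => g (phi z d))).
Qed.

Lemma le_opA g h : (forall z, g z <= h z)%E -> forall z, (A g z <= A h z)%E.
Proof. by move=> gh z; apply: le_concave_envelope. Qed.

Lemma opA_convex g z d d' (l : R) : 0 < l -> l < 1 ->
  l *: d + (1 - l) *: d' = 0 ->
  (l%:E * g (phi z d) + (1 - l)%:E * g (phi z d') <= A g z)%E.
Proof.
move=> l0 l1 dd; rewrite /A /opA -dd.
exact: (concave_envelope_convex (fun d => g (phi z d))).
Qed.

Lemma iter_opA_le g u : (forall z, A u z <= u z)%E -> (forall z, g z <= u z)%E ->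
  forall n z, (iter n A g z <= u z)%E.
Proof.
move=> Au gu; elim=> [|n IH] z //=.
exact: le_trans (le_opA _ _ IH z) (Au z).
Qed.

Lemma nondecreasing_iter_opA g z : nondecreasing_seq (fun n => iter n A g z).
Proof. by apply/nondecreasing_seqP => n; exact: opA_ge. Qed.

Lemma is_cvg_iter_opA g z : cvgn (fun n => iter n A g z).
Proof. exact: ereal_nondecreasing_is_cvgn (nondecreasing_iter_opA g z). Qed.

Lemma iter_opA_le_infty g n z : (iter n A g z <= opA_infty (@phi R X) g z)%E.
Proof.
rewrite /opA_infty.
rewrite (cvg_lim _ (ereal_nondecreasing_cvgn (nondecreasing_iter_opA g z)))//.
by apply: ereal_sup_ubound; exists n.
Qed.

Lemma opA_infty_le g u : (forall z, A u z <= u z)%E -> (forall z, g z <= u z)%E ->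
  forall z, (opA_infty (@phi R X) g z <= u z)%E.
Proof.
move=> Au gu z; apply: lime_le; first exact: is_cvg_iter_opA.
by apply: nearW => n; exact: iter_opA_le.
Qed.

(** A combination of values of the [n]-th iterate is at most the iterate of index [n + 1] at [z],
    hence at most the limit. Finiteness of [w] allows passing to the limit in the sum. *)
Lemma opA_infty_convex g (w : coneZ X -> R) z d d' (l : R) :
  (forall z, opA_infty (@phi R X) g z = (w z)%:E) -> 0 < l -> l < 1 ->
  l *: d + (1 - l) *: d' = 0 ->
  l * w (phi z d) + (1 - l) * w (phi z d') <= w z.
Proof.
move=> gw l0 l1 dd.
have cw z' : (fun n => iter n A g z') @ \oo --> (w z')%:E.
  by rewrite -gw; exact: is_cvg_iter_opA.
have cl : (fun n => l%:E * iter n A g (phi z d)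
    + (1 - l)%:E * iter n A g (phi z d'))%E @ \oo -->
    (l%:E * (w (phi z d))%:E + (1 - l)%:E * (w (phi z d'))%:E)%E.
  by apply: cvgeD => //; apply: cvgeZl.
rewrite -lee_fin EFinD !EFinM; apply: cvge_le cl.
apply: nearW => n /=; rewrite -gw.
apply: le_trans (iter_opA_le_infty g n.+1 z).
exact: opA_convex.
Qed.

End Operator.

(** * Diagonal points and the limiting argument for the best constant *)

Lemma diag_subproof {R : realType} {X : normedModType R} (x : X) :
  let w := (x, `|x|) in ((0 <= w.2) && (`|w.1| <= w.2))%R.
Proof. by rewrite /= normr_ge0 lexx. Qed.

Definition diag {R : realType} {X : normedModType R} (x : X) : coneZ X :=
  exist _ (x, `|x|) (diag_subproof x).

(** The limit [s -> 1] from the right, in elementary form. *)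
Lemma ler_mul_gt1 {R : realFieldType} (a b c : R) :
  (forall s, 1 < s -> a <= b + c * s) -> a <= b + c.
Proof.
move=> h; apply/ler_addgt0Pr => e e0.
have [c0|c0] := leP c 0.
  have := h 2 _; rewrite ltr1n => /(_ isT); lra.
have := h (1 + e / c) _; rewrite ltrDl divr_gt0// => /(_ isT).
rewrite mulrDr mulr1 mulrCA divff ?mulr1 ?gt_eqF//; lra.
Qed.

(** To first order as [a -> 1], the hypothesis becomes [C (p - 1) (b - 1) <= b^p - 1], whose right
    side is at most [p (b - 1) b^(p-1)]. Dividing by [(p - 1) (b - 1)] gives [C <= q b^(p-1)], and
    then [b -> 1]. *)
Lemma diag_bound_limit {R : realType} (p C : R) :
  1 < p -> let q := p / (p - 1) in
  (forall a b l : R, 1 < a -> 1 < b -> b < q -> 0 < l -> l < 1 ->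
     l * a + (1 - l) * (b / q) = 1 ->
     C <= l * (C * a `^ p) + (1 - l) * (b `^ p - 1)) ->
  C <= q.
Proof.
move=> p1 q H.
have p0 : 0 < p by lra.
have qE : q * (p - 1) = p by rewrite /q; field; lra.
have q1 : 1 < q by rewrite /q ltr_pdivlMr; lra.
have [//|qC] := leP C q.
have C0 : 0 < C by lra.
have one (r : R) : 1 `^ r = 1 by rewrite powR1.
(* Working with [s = a^(p-1)] makes the constraint affine in [s], so that
   the limit [s -> 1] is elementary; likewise for [b^(p-1)]. *)
have root s : 1 < s -> exists2 a, 1 < a & a `^ (p - 1) = s.
  move=> s1; exists (s `^ (p - 1)^-1).
    rewrite -[ltLHS](one (p - 1)^-1); apply: gt0_ltr_powR; rewrite ?nnegrE; try lra.
    by rewrite invr_gt0; lra.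
  by rewrite -powRrM mulVf ?powRr1; lra.
have step s b : 1 < s -> 1 < b -> b < q ->
    C * (1 - (1 - (p - 1) * (b - 1)) * s) <= p * (b - 1) * b `^ (p - 1).
  move=> s1 b1 bq; have [a a1 sE] := root s s1.
  set al := b / q.
  have al1 : al < 1 by rewrite /al ltr_pdivrMr; lra.
  have al0 : 0 < al by rewrite /al divr_gt0; lra.
  have D0 : 0 < a - al by lra.
  (* The weight forced by [l a + (1 - l) al = 1]. Multiplying the hypothesis by [a - al] clears its
     denominator. *)
  set l := (1 - al) / (a - al).
  have lD : l * (a - al) = 1 - al by rewrite /l divfK //; lra.
  have l0 : 0 < l by rewrite /l divr_gt0 //; lra.
  have l1 : l < 1 by rewrite /l ltr_pdivrMr; lra.
  have h := H a b l a1 b1 bq l0 l1 ltac:(rewrite -/al; lra).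
  have h1 : C * (a - al) <= (1 - al) * (C * a `^ p) + (a - 1) * (b `^ p - 1).
    have := ler_wpM2r (ltW D0) h.
    have -> : (l * (C * a `^ p) + (1 - l) * (b `^ p - 1)) * (a - al) =
      (l * (a - al)) * (C * a `^ p) + ((a - al) - l * (a - al)) * (b `^ p - 1).
      ring.
    rewrite lD; lra.
  have a0 : 0 <= a by lra.
  have b0 : 0 <= b by lra.
  have ya := powR_young p a 1 p1 a0 ler01.
  have yb := powR_young p b 1 p1 b0 ler01.
  have ea := mulr_powRB1 a0 p0.
  have eb := mulr_powRB1 b0 p0.
  rewrite one mulr1 in ya.
  rewrite one mulr1 in yb.
  rewrite sE in ya ea.
  have alE : (1 - al) * p = 1 - (p - 1) * (b - 1).
    have : al * p = b * (p - 1).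
      rewrite /al /q; field; apply/andP; split; lra.
    lra.
  (* Both power differences are bounded by the slope at the right endpoint. A factor [a - 1] then
     appears throughout and is cancelled before the limit. *)
  have ap : a `^ p - 1 <= (a - 1) * (p * s).
    have : p * a `^ p = p * (a * s) by rewrite ea.
    lra.
  have bp : b `^ p - 1 <= p * (b - 1) * b `^ (p - 1).
    have : p * b `^ p = p * (b * b `^ (p - 1)) by rewrite eb.
    lra.
  have h2 : C * ((1 - al) * (a `^ p - 1)) <= C * ((1 - al) * ((a - 1) * (p * s))).
    by rewrite ler_pM2l // ler_pM2l //; lra.
  have h3 : (a - 1) * (C * (1 - (1 - al) * p * s)) <= (a - 1) * (b `^ p - 1) by lra.
  rewrite ler_pM2l in h3; last lra.
  rewrite alE in h3; lra.
have step1 b : 1 < b -> b < q -> C <= q * b `^ (p - 1).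
  move=> b1 bq.
  have : C <= p * (b - 1) * b `^ (p - 1) + C * (1 - (p - 1) * (b - 1)).
    by apply: ler_mul_gt1 => s s1; have := step s b s1 b1 bq; lra.
  move=> h; have : (p - 1) * (b - 1) * C <= (p - 1) * (b - 1) * (q * b `^ (p - 1)).
    have -> : (p - 1) * (b - 1) * (q * b `^ (p - 1)) =
        (q * (p - 1)) * (b - 1) * b `^ (p - 1) by ring.
    rewrite qE; lra.
  by rewrite ler_pM2l // mulr_gt0; lra.
(* A value of [b^(p-1)] in []1, C / q[], contradicting [step1]. The second midpoint ensures
   [b < q]. *)
set t := Num.min ((C / q + 1) / 2) ((q `^ (p - 1) + 1) / 2).
have Cq1 : 1 < C / q by rewrite ltr_pdivlMr; lra.
have qp1 : 1 < q `^ (p - 1).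
  by rewrite -[ltLHS](one (p - 1)); apply: gt0_ltr_powR; rewrite ?nnegrE; lra.
have t1 : 1 < t by rewrite /t lt_min; apply/andP; split; lra.
have [b b1 bE] := root t t1.
have bq : b < q.
  rewrite ltNge; apply/negP => qb.
  have : q `^ (p - 1) <= b `^ (p - 1) by apply: ge0_ler_powR; rewrite ?nnegrE; lra.
  rewrite bE /t le_min => /andP[_]; lra.
have := step1 b b1 bq; rewrite bE.
have tC : t < C / q by rewrite /t gt_min; apply/orP; left; lra.
have : q * t < C by rewrite mulrC -ltr_pdivlMr; lra.
lra.
Qed.

(** * Lower bounds, first on the diagonal and then off it *)

Section LowerBound.
Context {R : realType} {X : normedModType R}.
Context (p : R) (w : coneZ X -> R).
Context (payoff_le : forall z, payoff p z <= w z).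
Context (w_convex : forall z d d' (l : R), 0 < l -> l < 1 ->
  l *: d + (1 - l) *: d' = 0 ->
  l * w (phi z d) + (1 - l) * w (phi z d') <= w z).

(** The displacement [(a - 1) x] leads from [x] to [a x], and the condition on [l] says that the
    mean displacement vanishes. *)
Lemma w_convex_ray (z : coneZ X) (a b l : R) :
  0 < l -> l < 1 -> l * a + (1 - l) * b = 1 ->
  l * w (phi z ((a - 1) *: xpart z)) + (1 - l) * w (phi z ((b - 1) *: xpart z))
    <= w z.
Proof.
move=> l0 l1 lab; apply: w_convex => //.
rewrite !scalerA -scalerDl.
have -> : l * (a - 1) + (1 - l) * (b - 1) = 0 by lra.
by rewrite scale0r.
Qed.

Lemma xpart_phi_ray (z : coneZ X) (a : R) :
  xpart (phi z ((a - 1) *: xpart z)) = a *: xpart z.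
Proof. by rewrite {1}/xpart /= scalerBl scale1r addrC subrK. Qed.

Lemma ypart_phi (z : coneZ X) d :
  ypart (phi z d) = Num.max (ypart z) `|xpart (phi z d)|.
Proof. by []. Qed.

Lemma phi_ray_diag (z : coneZ X) (a : R) : 0 <= a -> ypart z <= a * `|xpart z| ->
  phi z ((a - 1) *: xpart z) = diag (a *: xpart z).
Proof.
move=> a0 ya; apply: coneZ_inj; first exact: xpart_phi_ray.
rewrite ypart_phi xpart_phi_ray normrZ (ger0_norm a0) /ypart /= normrZ (ger0_norm a0).
exact/max_idPr.
Qed.

Lemma payoff_phi_ray (z : coneZ X) (a : R) :
  1 < p -> 0 <= a -> a * `|xpart z| <= ypart z ->
  payoff p (phi z ((a - 1) *: xpart z))
  = ypart z `^ p - (p / (p - 1) * (a * `|xpart z|)) `^ p.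
Proof.
move=> p1 a0 ya; rewrite /payoff ypart_phi xpart_phi_ray normrZ (ger0_norm a0).
have q0 : 0 <= p / (p - 1) by apply: divr_ge0; lra.
have ax0 : 0 <= a * `|xpart z| by rewrite mulr_ge0.
by rewrite (max_idPl ya) -powRM.
Qed.

Lemma diag_ge (x : X) : 1 < p -> - (p / (p - 1) * `|x| `^ p) <= w (diag x).
Proof.
move=> p1; set q := p / (p - 1).
have p0 : 0 < p by lra.
have q1 : 1 < q by rewrite /q ltr_pdivlMr; lra.
have [->|x0] := eqVneq x 0.
  apply: le_trans (payoff_le _); rewrite /payoff /xpart /ypart /= normr0.
  by rewrite powR0 ?gt_eqF// !mulr0 subr0 oppr0.
(* The supremum runs over all nonzero points, so the same constant serves at [x'] and at [a *: x'].
   It is finite because the payoff on the diagonal is [(1 - q^p) |x|^p]. *)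
pose S := [set - w (diag x) / `|x| `^ p | x in [set x : X | x != 0]].
have np x' : x' != 0 :> X -> 0 < `|x'| `^ p by move=> h; rewrite powR_gt0// normr_gt0.
have ubS : has_ubound S.
  exists (q `^ p - 1) => _ [x' /np x'0 <-].
  rewrite ler_pdivrMr//.
  by have := payoff_le (diag x'); rewrite /payoff /xpart /ypart /= -/q; lra.
have Sle x' : x' != 0 -> - w (diag x') <= sup S * `|x'| `^ p.
  by move=> h; rewrite -ler_pdivrMr ?np//; apply: ub_le_sup => //; exists x'.
suff Sq : sup S <= q.
  by have := Sle x x0; have := ler_wpM2r (ltW (np x x0)) Sq; lra.
apply: diag_bound_limit => // a b l a1 b1; rewrite -/q => bq l0 l1 lab.
apply: ge_sup; first by exists (- w (diag x) / `|x| `^ p), x.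
move=> _ [x' /= x'0 <-]; rewrite ler_pdivrMr ?np//.
have a0 : 0 < a by lra.
have bq0 : 0 <= b / q by apply: divr_ge0; lra.
have bq1 : b / q <= 1 by rewrite ler_pdivrMr; lra.
have n0 := normr_ge0 x'.
have := w_convex_ray (diag x') a (b / q) l l0 l1 lab.
rewrite phi_ray_diag; [|lra|rewrite /ypart /xpart /=; nra].
have h1 := Sle (a *: x'); rewrite scaler_eq0 negb_or gt_eqF//= in h1.
have {h1} := h1 x'0; rewrite normrZ (gtr0_norm a0) powRM; [|lra|lra] => h1.
(* Since [b < q], this move leaves the maximum at [|x'|], and the payoff reached is
   [(1 - b^p) |x'|^p]. *)
have h2 := payoff_le (phi (diag x') ((b / q - 1) *: x')).
rewrite payoff_phi_ray in h2; [|lra|lra|rewrite /ypart /xpart /=; nra].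
rewrite {1}/ypart {1}/xpart /= -/q in h2.
have e : q * (b / q * `|x'|) = b * `|x'| by field; lra.
rewrite {}e powRM in h2; [|lra|lra].
have l1' : 0 < 1 - l by lra.
have h3 := ler_wpM2l (ltW l0) h1.
have h4 := ler_wpM2l (ltW l1') h2.
rewrite {1}/xpart /=.
lra.
Qed.

Lemma utilde_le (z : coneZ X) :
  1 < p -> (p - 1) / p * ypart z <= `|xpart z| -> utilde p z <= w z.
Proof.
move=> p1; have p0 : 0 < p by lra.
have y0 := ypart_ge0 z; have xy := xpart_le z.
have yp := mulr_powRB1 y0 p0.
have qE : p ^+ 2 / (p - 1) = p * (p / (p - 1)) by field; lra.
set q := p / (p - 1) in qE.
have q1 : 1 < q by rewrite /q ltr_pdivlMr; lra.
have pq : q * (p - 1) = p by rewrite /q; field; lra.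
(* On the line [|x| = y / q], both [utilde] and the payoff vanish. *)
rewrite le_eqVlt => /predU1P[xE|].
  apply: le_trans (payoff_le z); rewrite /utilde /payoff -/q.
  rewrite -powRM; [|lra|exact: normr_ge0].
  rewrite -xE.
  have -> : q * ((p - 1) / p * ypart z) = ypart z.
    by rewrite /q; field; apply/andP; split; lra.
  rewrite le_eqVlt; apply/orP; left; apply/eqP; rewrite -yp; field.
  by apply/andP; split; lra.
rewrite mulrAC ltr_pdivrMr// => lx.
(* On the diagonal, [p q = p + q] turns [utilde] into [- q y^p], the bound of [diag_ge]. *)
move: xy; rewrite le_eqVlt => /predU1P[xE|xy].
  have zE : z = diag (xpart z) by apply: coneZ_inj.
  rewrite [in leRHS]zE; apply: le_trans (diag_ge _ p1).
  rewrite /utilde -/q qE xE.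
  have e : p * q * (ypart z * ypart z `^ (p - 1)) = (p + q) * ypart z `^ p.
    rewrite yp; congr (_ * _); rewrite /q; field; lra.
  lra.
have {}y0 : 0 < ypart z by apply: le_lt_trans xy; exact: normr_ge0.
have x0 : 0 < `|xpart z| by rewrite -(pmulr_lgt0 _ p0); nra.
set r := `|xpart z| in x0 xy lx *; set y := ypart z in y0 yp lx xy *.
(* The weight solving [r = l y + (1 - l) y / q]. The scalings [y / r] and [y / (q r)] carry the norm
   [r] to these two endpoints. *)
set l := (p * r - (p - 1) * y) / y.
have lE : l * y = p * r - (p - 1) * y by rewrite /l divfK//; lra.
have l0 : 0 < l by rewrite /l divr_gt0//; lra.
have l1 : l < 1 by rewrite /l ltr_pdivrMr// mul1r; nra.
have lab : l * (y / r) + (1 - l) * (y / (q * r)) = 1.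
  rewrite /l /q; field; do ?(apply/andP; split); lra.
have ar : y / r * r = y by rewrite divfK//; lra.
have br : q * (y / (q * r) * r) = y by field; apply/andP; split; lra.
have a0 : 0 <= y / r by apply: divr_ge0; lra.
have b0 : 0 <= y / (q * r) by apply: divr_ge0; [|apply: mulr_ge0]; lra.
have := w_convex_ray z _ _ l l0 l1 lab.
rewrite phi_ray_diag//; last by rewrite -/r ar.
have h1 := diag_ge (y / r *: xpart z) p1.
rewrite normrZ (ger0_norm a0) -/r ar -/q in h1.
have h2 := payoff_le (phi z ((y / (q * r) - 1) *: xpart z)).
rewrite payoff_phi_ray// in h2; last first.
  by rewrite -/r -/y -[leRHS]br; apply: ler_peMl; [apply: mulr_ge0 => //|]; exact: ltW.
rewrite -/q -/r -/y br subrr in h2.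
have l1' : 0 < 1 - l by lra.
have h3 := ler_wpM2l (ltW l0) h1.
have h4 := ler_wpM2l (ltW l1') h2.
rewrite /utilde qE -/r -/y.
(* For fixed [y], [utilde] is affine in [r], with value [- q y^p] at [r = y] and [0] at
   [r = y / q]. *)
suff : p * y `^ p - p * q * r * y `^ (p - 1) = l * - (q * y `^ p) by lra.
rewrite -yp.
have -> : l * - (q * (y * y `^ (p - 1))) = - ((l * y) * q * y `^ (p - 1)) by ring.
rewrite lE -[X in X * (y * _) - _]pq; ring.
Qed.

End LowerBound.

(** * The candidate on the cone and the identification of the limit *)

Lemma bellmanE {R : realType} {X : normedModType R} (p : R) (z : coneZ X) :
  bellman p `|xpart z| (ypart z) =
  if `|xpart z| < (p - 1) / p * ypart z then payoff p z else utilde p z.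
Proof. by []. Qed.

(** On the outer branch, [utilde] is the tangent to the concave function [y^p - t^p] of [t = q |x|]
    at [t = y]. *)
Lemma payoff_le_bellman {R : realType} {X : normedModType R} (p : R) (z : coneZ X) :
  1 < p -> payoff p z <= bellman p `|xpart z| (ypart z).
Proof.
move=> p1; rewrite /bellman; case: ifPn => // _; rewrite /payoff.
have p0 : 0 < p by lra.
have y0 := ypart_ge0 z.
have q0 : 0 <= p / (p - 1) by apply: divr_ge0; lra.
rewrite -powRM//.
have := powR_young p (ypart z) (p / (p - 1) * `|xpart z|) p1 y0.
have -> : p ^+ 2 / (p - 1) = p * (p / (p - 1)) by field; lra.
by rewrite mulr_ge0// => /(_ isT); lra.
Qed.

Lemma opA_bellman {R : realType} {X : normedModType R} (p : R) (z : coneZ X) :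
  1 < p ->
  let u : coneZ X -> \bar R := fun z => (bellman p `|xpart z| (ypart z))%:E in
  opA (@phi R X) u z = u z.
Proof.
move=> p1 u; apply/eqP; rewrite eq_le opA_ge andbT -[in leRHS](phi0 z).
apply: (concave_envelope_le (fun d => u (phi z d))) => d d' l l0 l1.
rewrite /u -!EFinM -EFinD lee_fin !ypart_phi.
have := bellman_concave p _ p1 (ypart_ge0 z) (xpart z + d) (xpart z + d')
  l l0 l1.
rewrite {1 2 3}/xpart /=.
have -> // : l *: (xpart z + d) + (1 - l) *: (xpart z + d') =
  xpart z + (l *: d + (1 - l) *: d').
rewrite !scalerDr addrACA -scalerDl.
have -> : l + (1 - l) = 1 by lra.
by rewrite scale1r.
Qed.

Theorem proposition4p1 (R : realType) (X : normedModType R) (p : R) (hp : 1 < p) :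
  let f : coneZ X -> \bar R := fun z => (payoff p z)%:E in
  let A : (coneZ X -> \bar R) -> (coneZ X -> \bar R) := opA (@phi R X) in
  let Ainf : coneZ X -> \bar R := opA_infty (@phi R X) f in
  [/\ forall z : coneZ X, cvgn (fun n => iter n A f z),
      is_minimal_fixed_point A f Ainf
    & forall z : coneZ X,
        Ainf z = if `|xpart z| < (p - 1) / p * ypart z
                 then (payoff p z)%:E else (utilde p z)%:E].
Proof.
move=> f A Ainf.
pose u (z : coneZ X) : \bar R := (bellman p `|xpart z| (ypart z))%:E.
have Au z : A u z = u z by exact: opA_bellman.
have fu z : (f z <= u z)%E by rewrite lee_fin payoff_le_bellman.
have fA z : (f z <= Ainf z)%E by exact: (iter_opA_le_infty f 0).
have Ainfu z : (Ainf z <= u z)%E by apply: opA_infty_le => // z'; rewrite -/A Au.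
(* The limit lies between the finite functions [f] and [u], so the real-valued lower bounds apply to
   it. *)
pose w z := fine (Ainf z).
have AinfE z : Ainf z = (w z)%:E.
  rewrite fineK// fin_numElt (lt_le_trans _ (fA z)) ?ltNyr//=.
  by rewrite (le_lt_trans (Ainfu z)) ?ltry.
have wconv := fun z d d' l => opA_infty_convex f w z d d' l AinfE.
have wf z : payoff p z <= w z by rewrite -lee_fin -AinfE; exact: fA.
have AinfuE z : Ainf z = u z.
  apply/eqP; rewrite eq_le Ainfu /= AinfE lee_fin bellmanE.
  by case: ltP => // h; exact: utilde_le.
have -> : Ainf = u by apply/funext.
split.
- by move=> z; exact: is_cvg_iter_opA.
(* The fixed-point property is that of [u]. Any fixed point [v] above [f] dominates every iterate by
   monotonicity, hence the limit. *)
- split=> //; first exact/funext.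
  move=> v Av fv z; rewrite -AinfuE; apply: opA_infty_le => // z'.
  by rewrite -/A Av.
- by move=> z; rewrite /u bellmanE; case: ifP.
Qed.
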